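(* Let $\alpha$ and $k$ be positive integers and let $c\in\mathbb{Z}_{2^{\alpha}}$. Then $$\mathscr{S}_{sq}(\mathbb{Z}_{2^{\alpha}},c,k)=\begin{cases} 1 & \text{if } \alpha=1 \text{ and } c\equiv k \pmod 2,\\ 2^{k} & \text{if } \alpha=2 \text{ and } c\equiv k \pmod 4,\\ 2^{2k+(\alpha-3)(k-1)} & \text{if } \alpha>2 \text{ and } c\equiv k \pmod 8,\\ 0 & \text{otherwise.}\end{cases}$$
   Context: $\mathbb{Z}_n$ is the ring of residue classes modulo $n$ and $\mathbb{Z}_n^{\ast}$ its group of units. For $c\in\mathbb{Z}_n$ and a positive integer $k$, $\mathscr{S}_{sq}(\mathbb{Z}_n,c,k)$ denotes the number of tuples $(x_1,\ldots,x_k)\in(\mathbb{Z}_n^{\ast})^k$ with $x_1^2+\cdots+x_k^2=c$ in $\mathbb{Z}_n$. *)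

(* Defs.v *)
From mathcomp Require Import all_boot all_algebra all_fingroup.

Set Implicit Arguments.
Unset Strict Implicit.
Unset Printing Implicit Defensive.

Import GRing.Theory.

(* For Z_n take R := 'Z_n with 1 < n, since 'Z_0 and 'Z_1 are both Z/2. *)
Definition S_sq (R : finComUnitRingType) (c : R) (k : nat) : nat :=
  #|[set x : k.-tuple {unit R} |
      (\sum_(i < k) (val (tnth x i)) ^+ 2 == c)%R]|.

(* Main.v *)
Require Import Defs.
From mathcomp Require Import all_boot all_algebra all_fingroup.
From mathcomp Require Import zify.

(** Put q = gcd(2^alpha, 8).  Squares of units are congruent to 1 modulo q, and
    conversely (Hensel lifting) every element congruent to 1 modulo q is the
    square of a unit.  The nonempty fibres of the squaring map are translates of
    one another, so they all have the same size, which is found by counting the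
    2^(alpha-1) units along the 2^alpha / q squares.  The count of
    representations then follows by induction on k: all but one of the units are
    free, and the last one is a square root of what remains. *)

Set Implicit Arguments.
Unset Strict Implicit.
Unset Printing Implicit Defensive.

Import GRing.Theory.

Definition unit_sqrts (R : finComUnitRingType) (d : R) : {set {unit R}} :=
  [set u | (val u ^+ 2 == d)%R].

Lemma S_sq1 (R : finComUnitRingType) (c : R) : S_sq c 1 = #|unit_sqrts c|.
Proof.
rewrite /S_sq -(card_imset (unit_sqrts c) (f := fun u => [tuple u])); last first.
  by move=> u v /(congr1 val) [].
apply: eq_card => x; rewrite !inE big_ord1; apply/idP/imsetP.
  move=> h; exists (thead x); first by rewrite inE.
  by apply/val_inj; case: x {h} => [[|a [|]]].
by case=> u; rewrite inE => hu ->.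
Qed.

Lemma S_sqS (R : finComUnitRingType) (c : R) k :
  S_sq c k.+1 = \sum_(u : {unit R}) S_sq (c - val u ^+ 2)%R k.
Proof.
rewrite /S_sq -sum1dep_card (partition_big (fun x => thead x) predT) //=.
apply: eq_bigr => u _; rewrite sum1dep_card.
have inj_cons : injective (fun x : k.-tuple {unit R} => [tuple of u :: x]).
  by move=> x y /(congr1 val) [] /val_inj.
rewrite -(card_imset _ inj_cons); apply: eq_card => x; rewrite !inE.
apply/andP/imsetP.
  case: (tupleP x) => v y []; rewrite theadE big_ord_recl tnth0 => hy /eqP <-.
  exists y => //; rewrite inE eq_sym subr_eq addrC -(eqP hy).
  by under [X in (_ + X == _)%R]eq_bigr do rewrite tnthS.
case=> y; rewrite inE => /eqP hy ->; rewrite theadE big_ord_recl tnth0; split=> //.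
by under eq_bigr do rewrite tnthS; rewrite hy addrC subrK.
Qed.

(** In the application, [P k d] is the congruence of [d] to [k] modulo [q]. Since its truth after
    subtracting a unit square does not depend on the unit, all terms of the sum in [S_sqS] are
    equal. *)
Lemma S_sq_of_sqrts (R : finComUnitRingType) (P : nat -> pred R) r :
    (forall d, #|unit_sqrts d| = if P 1 d then r else 0) ->
    (forall k d (u : {unit R}), P k (d - val u ^+ 2)%R = P k.+1 d) ->
  forall k c, S_sq c k.+1 = if P k.+1 c then r * #|{: {unit R}}| ^ k else 0.
Proof.
move=> card_sqrts PS; elim=> [|k IHk] c; first by rewrite S_sq1 muln1.
rewrite S_sqS; under eq_bigr do rewrite IHk PS.
by rewrite sum_nat_const; case: ifP; rewrite ?muln0 // expnS mulnCA.
Qed.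

(** Multiplication by [u] maps the square roots of 1 bijectively onto those of [u ^+ 2]. *)
Lemma card_unit_sqrts (R : finComUnitRingType) (u : {unit R}) :
  #|unit_sqrts (val u ^+ 2)%R| = #|unit_sqrts (1 : R)%R|.
Proof.
rewrite -(card_imset (unit_sqrts 1%R) (mulgI u)); apply: eq_card => v.
rewrite inE; apply/eqP/imsetP => [hv | [w]].
  exists (u^-1 * v)%g; last by rewrite mulKVg.
  by rewrite inE FinRing.val_unitM FinRing.val_unitV exprMn hv
    exprVn mulVr ?unitrX ?(valP u).
by rewrite inE => /eqP hw ->; rewrite FinRing.val_unitM exprMn hw mulr1.
Qed.

Lemma sum_card_unit_sqrts (R : finComUnitRingType) :
  \sum_(d : R) #|unit_sqrts d| = #|{: {unit R}}|.
Proof.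
rewrite -sum1_card (partition_big (fun u => val u ^+ 2)%R predT) //=.
by apply: eq_bigr => d _; rewrite -sum1dep_card.
Qed.

Lemma card_ord_mod q t : 1 < q -> #|[set d : 'I_(q * t) | d == 1 %[mod q]]| = t.
Proof.
move=> q_gt1; have lt_f (i : 'I_t) : q * i + 1 < q * t.
  have := ltn_ord i; nia.
have inj_f : injective (fun i => Ordinal (lt_f i)).
  by move=> i j /(congr1 val) /= h; apply/val_inj => /=; nia.
rewrite -[RHS]card_ord -cardsT -(card_imset _ inj_f); apply: eq_card => d.
rewrite inE (modn_small q_gt1); apply/eqP/imsetP => [hd | [i _ ->]]; last first.
  by rewrite /= mulnC modnMDl modn_small.
have lt_d : d %/ q < t by rewrite ltn_divLR ?(ltnW q_gt1) // [ltnRHS]mulnC.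
exists (Ordinal lt_d) => //; apply/val_inj.
by rewrite /= [LHS](divn_eq d q) hd [_ %/ _ * _]mulnC.
Qed.

Lemma odd_sqr_mod8 x : odd x -> x ^ 2 = 1 %[mod 8].
Proof.
move=> x_odd; rewrite -modnXm.
have: odd (x %% 8) by rewrite odd_mod.
have: x %% 8 < 8 by rewrite ltn_pmod.
by case: (x %% 8) => [|[|[|[|[|[|[|[|]]]]]]]].
Qed.

(** Numbers congruent modulo [m] can differ modulo [2 * m] only in the parity of their quotient by
    [m], and adding [m] flips that parity. *)
Lemma modn_shift_half m a b : 0 < m -> a = b %[mod m] ->
  a %% (m * 2) != b %% (m * 2) -> a + m = b %[mod m * 2].
Proof.
move=> m_gt0 eq_ab; have lt_r : b %% m < m by rewrite ltn_pmod.
have decomp x : x = b %[mod m] -> x %% (m * 2) = odd (x %/ m) * m + b %% m.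
  move=> eq_xb; rewrite [in LHS](divn_eq x m) eq_xb -[in LHS](odd_double_half (x %/ m)).
  rewrite -muln2 mulnDl -mulnA [2 * m]mulnC addnAC addnC modnMDl modn_small //.
  by case: odd; lia.
rewrite (decomp (a + m)) ?modnDr // (decomp a) // (decomp b) //.
by rewrite divnDr // divnn m_gt0 oddD addbT; do 2!case: odd; rewrite ?eqxx.
Qed.

(* Adding 2^(j+2) to x changes x^2 by 2^(j+3) modulo 2^(j+4). *)
Lemma sqr_mod_2expn d j : d = 1 %[mod 8] ->
  exists2 x, odd x & x ^ 2 = d %[mod 2 ^ (j + 3)].
Proof.
move=> hd; elim: j => [|j [x x_odd hx]]; first by exists 1.
have [hx' | hx'] := eqVneq (x ^ 2 %% 2 ^ (j.+1 + 3)) (d %% 2 ^ (j.+1 + 3)).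
  by exists x.
exists (x + 2 ^ (j + 2)).
  by rewrite oddD x_odd oddX addn2.
move: hx hx'; rewrite sqrnD.
have ->: 2 ^ (j.+1 + 3) = 2 ^ (j + 3) * 2 by rewrite addSn expnSr.
have ->: (2 ^ (j + 2)) ^ 2 = 2 ^ (j + 3) * 2 * 2 ^ j.
  by rewrite -expnM -expnSr -expnD; congr (_ ^ _); lia.
have ->: 2 * (x * 2 ^ (j + 2)) = 2 ^ (j + 3) * x.
  by rewrite [j + 3]addnS expnS -mulnA [x * _]mulnC.
(* As [x] is odd, the cross term [2 ^ (j + 3) * x] is congruent to [2 ^ (j + 3)] modulo
   [2 ^ (j + 4)]. *)
have ->: x = 2 * x./2 + 1 by lia.
set m := 2 ^ (j + 3); have m_gt0 : 0 < m by rewrite expn_gt0.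
set y := (_ + _) ^ 2 => hx hx'.
have ->: y + m * 2 * 2 ^ j + m * (2 * x./2 + 1) =
    (2 ^ j + x./2) * (m * 2) + (y + m) by lia.
by rewrite modnMDl; apply: modn_shift_half.
Qed.

Lemma modn_val_Zp q n (x y : 'Z_n) : 1 < n -> q %| n ->
  nat_of_ord (x + y)%R = x + y %[mod q].
Proof. by case: n x y => [|[|n]] x y //= _ q_dvd; rewrite modn_dvdm. Qed.

Lemma modn_val_ZpX q n (x : 'Z_n) : 1 < n -> q %| n ->
  nat_of_ord (x ^+ 2)%R = x ^ 2 %[mod q].
Proof. by case: n x => [|[|n]] x //= _ q_dvd; rewrite modn_dvdm. Qed.

Section TwoPower.

Variable alpha : nat.
Hypothesis alpha_gt0 : 0 < alpha.

Let n := 2 ^ alpha.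
(** The minimum lets one argument cover the moduli 2, 4 and 8 of the three nonzero cases. *)
Let m := minn alpha 3.
Let q := 2 ^ m.

Let n_gt1 : 1 < n. Proof. by rewrite -[1]/(2 ^ 0) ltn_exp2l. Qed.
Let q_gt1 : 1 < q. Proof. by rewrite -[1]/(2 ^ 0) ltn_exp2l // /m; lia. Qed.
Let q_dvdn : q %| n. Proof. by rewrite dvdn_exp2l // /m; lia. Qed.
Let q_dvd8 : q %| 8. Proof. by rewrite -[8]/(2 ^ 3) dvdn_exp2l // /m; lia. Qed.

Lemma Zp_unit_odd (x : 'Z_n) : (x \is a GRing.unit)%R = odd x.
Proof. by rewrite -[x in LHS]natr_Zp unitZpE // coprime_pexpl // coprime2n. Qed.

Lemma unit_sqr_mod (u : {unit 'Z_n}) : nat_of_ord (val u ^+ 2)%R = 1 %[mod q].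
Proof.
rewrite modn_val_ZpX //; have u_odd: odd (val u) by rewrite -Zp_unit_odd (valP u).
by rewrite -(modn_dvdm _ q_dvd8) odd_sqr_mod8 // modn_dvdm.
Qed.

Lemma subr_unit_sqr_mod k (d : 'Z_n) (u : {unit 'Z_n}) :
  (nat_of_ord (d - val u ^+ 2)%R == k %[mod q]) = (d == k.+1 %[mod q]).
Proof.
rewrite -[in RHS](subrK (val u ^+ 2)%R d); move: (d - _)%R => e.
by rewrite modn_val_Zp // -modnDmr unit_sqr_mod modnDmr -[k.+1]addn1 eqn_modDr.
Qed.

Lemma unit_sqrt_exists (d : 'Z_n) : d = 1 %[mod q] ->
  exists u : {unit 'Z_n}, (val u ^+ 2)%R = d.
Proof.
move=> hd; have [x x_odd hx]: exists2 x, odd x & x ^ 2 = d %[mod n].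
  (* If [alpha <= 3] then [q = n], so 1 is already a root of [d]. Otherwise [q = 8], and lifting
     with [j = alpha - 3] reaches the modulus [2 ^ alpha]. *)
  have [alpha_le3 | alpha_gt3] := leqP alpha 3.
    by exists 1 => //; move: hd; rewrite /q /m (minn_idPl alpha_le3) => ->.
  have [|x x_odd] := @sqr_mod_2expn d (alpha - 3).
    by move: hd; rewrite /q /m (minn_idPr (ltnW alpha_gt3)).
  by rewrite subnK 1?ltnW //; exists x.
have x_unit : (x%:R : 'Z_n)%R \is a GRing.unit.
  by rewrite unitZpE // coprime_pexpl // coprime2n.
exists (FinRing.unit 'Z_n x_unit) => /=.
by rewrite -natrX -[RHS]natr_Zp -(Zp_nat_mod n_gt1 (x ^ 2)) hx Zp_nat_mod.
Qed.

Lemma card_unit_Zp_2exp : #|{: {unit 'Z_n}}| = 2 ^ alpha.-1.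
Proof.
rewrite -cardsT -[[set: _]]/(units_Zp n : {set _}) card_units_Zp ?expn_gt0 //.
by rewrite totient_pfactor // mul1n.
Qed.

Lemma card_unit_sqrts_mod (d : 'Z_n) :
  #|unit_sqrts d| = if d == 1 %[mod q] then #|unit_sqrts (1%R : 'Z_n)| else 0.
Proof.
case: eqP => [/unit_sqrt_exists[u <-] | hd]; first exact: card_unit_sqrts.
apply: eq_card0 => u; rewrite inE; apply/eqP=> hu; case: hd.
by rewrite -hu unit_sqr_mod.
Qed.

Lemma card_unit_sqrts1 : #|unit_sqrts (1%R : 'Z_n)| = 2 ^ m.-1.
Proof.
have := sum_card_unit_sqrts 'Z_n; rewrite card_unit_Zp_2exp.
under eq_bigr do rewrite card_unit_sqrts_mod.
rewrite -big_mkcond sum_nat_const.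
have ->: #|[pred d : 'Z_n | d == 1 %[mod q]]| = 2 ^ (alpha - m).
  rewrite -[RHS](card_ord_mod _ q_gt1) cardsE.
  (* ['Z_n] unfolds to the ordinals below [(Zp_trunc n).+2], which must be matched with the bound in
     [card_ord_mod]. *)
  have <- // : (Zp_trunc n).+2 = q * 2 ^ (alpha - m).
  by rewrite Zp_cast // -expnD subnKC // geq_minl.
(* Cancel the number of squares, using [alpha - 1 = (alpha - m) + (m - 1)]. *)
move=> h; apply/eqP; rewrite -(eqn_pmul2l (expn_gt0 2 (alpha - m))) h -expnD.
by apply/eqP; congr (_ ^ _); rewrite /m; lia.
Qed.

Lemma S_sq_2exp k (c : 'Z_n) :
  S_sq c k.+1 =
    if c == k.+1 %[mod q] then 2 ^ m.-1 * (2 ^ alpha.-1) ^ k else 0.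
Proof.
rewrite -card_unit_sqrts1 -card_unit_Zp_2exp.
apply: (@S_sq_of_sqrts _ (fun k (c : 'Z_n) => c == k %[mod q])).
  exact: card_unit_sqrts_mod.
by move=> *; apply: subr_unit_sqr_mod.
Qed.

End TwoPower.

(* MathComp; [c] coerces to its representative in [0, 2 ^ alpha). *)
Theorem theorem6p2 (alpha k : nat) (halpha : 0 < alpha) (hk : 0 < k)
    (c : 'Z_(2 ^ alpha)) :
  S_sq c k =
    if (alpha == 1) && (c == k %[mod 2]) then 1
    else if (alpha == 2) && (c == k %[mod 4]) then 2 ^ k
    else if (2 < alpha) && (c == k %[mod 8])
         then 2 ^ (2 * k + (alpha - 3) * (k - 1))
    else 0.
Proof.
case: k hk => // k _; rewrite (S_sq_2exp halpha).
case: alpha halpha c => [|[|[|alpha]]] //= _ c.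
- by rewrite exp1n.
- by rewrite [2 ^ k.+1]expnS.
(* Writing [a] for the original exponent, at least 3, and [k + 1] for the number of summands, the
   exponents agree because [2 + (a - 1) * k = 2 * (k + 1) + (a - 3) * k]. *)
rewrite -expnM -expnD; case: ifP => // _.
by congr (_ ^ _); lia.
Qed.
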